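(* In the setting below, assume $f(\cdot,\xi)$ is convex for all $\xi\in\Xi$. Then for all $N\in\mathbb N$, $$\theta^2\,\mathbb E\big[\|u_N^*-u^*\|_{\mathcal U}^{2(\varrho-1)}\big]\le \frac1N\,C_{\mathcal H;\mathcal U^*}^2\,\sigma_{\mathrm Df}^2.$$
   Context: Let $U$ be a separable Hilbert space (identified with its dual, inner product $(\cdot,\cdot)_U$), $W$ a separable Banach space with dual $W^*$, and $B:U\to W$ a compact linear operator with adjoint $B^*$. Let $\psi:U\to[0,\infty]$ be proper, closed and convex with bounded domain $\mathcal D(\psi)=\{u:\psi(u)<\infty\}$. Let $U_0\subset U$ be open, convex and bounded with $\mathcal D(\psi)\subset U_0$. Let $\Xi$ be a complete separable metric space, $\boldsymbol\xi$ a $\Xi$-valued random element, and $\boldsymbol\xi^1,\boldsymbol\xi^2,\ldots$ i.i.d. copies of $\boldsymbol\xi$ on a complete probability space $(\Omega,\mathcal F,P)$. Let $f:B(U_0)\times\Xi\to\mathbb R$ be such that $f(\cdot,\xi)$ is continuous on $B(\mathcal D(\psi))$, $f(w,\cdot)$ is measurable, and $|f(Bu,\xi)|\le \zeta_f(\xi)$ on $U_0\times\Xi$ with $\zeta_f$ integrable. Assume: for each $\xi$, $g_\xi(u)=f(Bu,\xi)$ is continuously differentiable on $U_0$; there is a Carathéodory map $\mathrm D_wf:B(\mathcal D(\psi))\times\Xi\to W^*$ with $\nabla g_\xi(u)=B^*\mathrm D_wf(Bu,\xi)$ on $\mathcal D(\psi)\times\Xi$; there is an integrable $\zeta_{\mathrm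 Df}$ with $\|\nabla g_\xi(u)\|_U\le\zeta_{\mathrm Df}(\xi)$ on $U_0\times\Xi$ and $\|\mathrm D_wf(Bu,\xi)\|_{W^*}\le\zeta_{\mathrm Df}(\xi)$ on $\mathcal D(\psi)\times\Xi$. Let $F(w)=\mathbb E[f(w,\boldsymbol\xi)]$, $\mathrm DF(w)=\mathbb E[\mathrm D_wf(w,\boldsymbol\xi)]$, $G(u)=F(Bu)+\psi(u)$, $\hat F_N(w)=\frac1N\sum_{i=1}^Nf(w,\boldsymbol\xi^i)$. Let $u^*$ be a solution of $\min_{u\in U}G(u)$ and for each $N$ let $u_N^*:\Omega\to U$ be measurable with $u_N^*(\omega)$ a solution of $\min_{u\in U}\hat F_N(Bu,\omega)+\psi(u)$. Further assume: $\mathcal U$ is a Banach space with $\mathcal U^*\hookrightarrow U\hookrightarrow\mathcal U$, $\mathcal H$ is a separable Hilbert space with $\mathcal H\hookrightarrow\mathcal U^*$ (embedding constant $C_{\mathcal H;\mathcal U^*}$), and $|(v,u)_U|\le\|v\|_{\mathcal U^*}\|u\|_{\mathcal U}$ for all $v\in\mathcal U^*$, $u\in U$; there are $\theta\in(0,\infty)$, $\varrho\in[2,\infty)$ with $(B^*\mathrm DF(Bu^* ),u-u^* )_U+\psi(u)-\psi(u^* )\ge\theta\|u-u^*\|_{\mathcal U}^{\varrho}$ for all $u\in U$; the map $\xi\mapsto\nabla g_\xi(u^* )\in\mathcal H$ is integrable and $\sigma_{\mathrm Df}=(\mathbb E[\|\nabla g_{\boldsymbol\xi}(u^* )-\mathbb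 E[\nabla g_{\boldsymbol\xi}(u^* )]\|_{\mathcal H}^2])^{1/2}<\infty$. *)

(* Defs.v *)
From mathcomp Require Import all_boot all_order all_algebra.
From mathcomp Require Import all_classical all_reals all_analysis.
Import numFieldNormedType.Exports.
Import Order.TTheory GRing.Theory Num.Theory.

Set Implicit Arguments.
Unset Strict Implicit.
Unset Printing Implicit Defensive.

Local Open Scope classical_set_scope.
Local Open Scope ring_scope.

Section Defs.
Variable R : realType.

Definition is_dual (V : normedModType R) (phi : V -> R) : Prop :=
  (forall (a : R) (x y : V), phi (a *: x + y) = a * phi x + phi y) /\
  continuous phi.

Definition dual_norm (V : normedModType R) (phi : V -> R) : R :=
  sup [set `|phi v| | v in [set v : V | `|v| <= 1]].

Definition dual_open (V : normedModType R) (O : set (V -> R)) : Prop :=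
  forall phi, O phi -> exists2 e : R, 0 < e &
    forall psi, is_dual psi -> dual_norm (fun v => psi v - phi v) < e -> O psi.

Definition dual_measurable (d : measure_display) (T : measurableType d)
  (V : normedModType R) (h : T -> (V -> R)) : Prop :=
  forall O : set (V -> R), dual_open O -> measurable (h @^-1` O).

Definition borel_measurable (d : measure_display) (T : measurableType d)
  (V : topologicalType) (h : T -> V) : Prop :=
  forall O : set V, open O -> measurable (h @^-1` O).

(** [ip] is an inner product inducing the norm of [V] (so [V], being complete,
    is a real Hilbert space). *)
Definition is_inner_product (V : normedModType R) (ip : V -> V -> R) : Prop :=
  (forall (a : R) (x y z : V), ip (a *: x + y) z = a * ip x z + ip y z) /\
  (forall x y : V, ip x y = ip y x) /\
  (forall x : V, ip x x = `|x| ^+ 2).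

Definition separable_space (V : topologicalType) : Prop :=
  exists D : set V, countable D /\ closure D = setT.

Definition polish_borel (d : measure_display) (T : measurableType d) : Prop :=
  exists dist : T -> T -> R,
    (forall x y, 0 <= dist x y /\ (dist x y = 0 <-> x = y)) /\
        (forall x y, dist x y = dist y x) /\
        (forall x y z, dist x z <= dist x y + dist y z) /\
        (forall s : nat -> T,
           (forall e : R, 0 < e -> exists n0 : nat, forall m n : nat,
              (n0 <= m)%N -> (n0 <= n)%N -> dist (s m) (s n) < e) ->
           exists l : T, forall e : R, 0 < e -> exists n0 : nat,
              forall n : nat, (n0 <= n)%N -> dist (s n) l < e) /\
        (exists D : set T, countable D /\
           forall x (e : R), 0 < e -> exists2 y, D y & dist x y < e) /\
        (@measurable d T = <<s [set A : set T | forall x, A x ->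
            exists2 e : R, 0 < e & forall y, dist x y < e -> A y] >>).

Definition mutually_independent (d : measure_display) (Omega : measurableType d)
  (dX : measure_display) (X : measurableType dX)
  (P : probability Omega R) (xs : nat -> Omega -> X) : Prop :=
  forall (s : seq nat) (A : nat -> set X), uniq s ->
    (forall i, measurable (A i)) ->
    P (\bigcap_(i in [set` s]) (xs i @^-1` A i)) =
    (\prod_(i <- s) P (xs i @^-1` A i))%E.

Definition Fexp (d : measure_display) (Omega : measurableType d)
  (P : probability Omega R) (dX : measure_display) (X : measurableType dX)
  (W : Type) (xi : Omega -> X) (f : W -> X -> R) (w : W) : R :=
  fine (\int[P]_om (f w (xi om))%:E)%E.

(** DF(w) = E[D_w f(w, xi)] as an element of W^* (evaluated pointwise). *)
Definition DFexp (d : measure_display) (Omega : measurableType d)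
  (P : probability Omega R) (dX : measure_display) (X : measurableType dX)
  (W : Type) (xi : Omega -> X) (Df : W -> X -> W -> R) (w : W) : W -> R :=
  fun v => fine (\int[P]_om (Df w (xi om) v)%:E)%E.

Definition FhatN (d : measure_display) (Omega : measurableType d)
  (dX : measure_display) (X : measurableType dX) (W : Type)
  (xis : nat -> Omega -> X) (f : W -> X -> R) (N : nat) (w : W) (om : Omega) : R :=
  N%:R^-1 * \sum_(i < N) f w (xis i om).

End Defs.

(* Main.v *)
Require Import Defs.
From HB Require Import structures.
From mathcomp Require Import all_boot all_order all_algebra.
From mathcomp Require Import all_classical all_reals all_analysis.
From mathcomp Require Import measurable_realfun ring lra.
Import numFieldNormedType.Exports.
Import Order.TTheory GRing.Theory Num.Theory.
Local Open Scope classical_set_scope.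
Local Open Scope ring_scope.

(** Write [h = uN - ustar], [r = |jU h|] and
    [S = \sum_(i < N) (gradH xi_i - meanH)]. Convexity gives the gradient
    inequality for the sample average at [ustar]; combined with the optimality
    of [uN] and with the growth condition at [uN] it yields
    [theta r^rho <= (Bstar DF - N^-1 \sum_i grad xi_i ustar, h)_U], where [DF]
    is taken at [B ustar]. The right-hand side is the pairing of [- N^-1 S] with
    [h], hence at most [C_H |N^-1 S| r]. Dividing by [r] and squaring reduces
    the theorem to [E |S|^2 = N sigma^2], which holds because the cross terms
    vanish: by independence and Fubini they are inner products against the zero
    mean. The mean in [H] is only given weakly, so that [Bstar DF] pairs with
    [h] as [meanH] does is seen by representing the functional
    [z |-> (kU (eH z), h)_U] on [H] with Riesz' theorem. *)

(** * Inner products: Cauchy-Schwarz and Riesz representation *)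

Section inner_product.
Context {R : realType} {V : normedModType R} {ip : V -> V -> R}.
Hypothesis ipP : is_inner_product ip.

Lemma ipC x y : ip x y = ip y x.
Proof. by have [_ [+ _]] := ipP; apply. Qed.

Lemma ip_norm x : ip x x = `|x| ^+ 2.
Proof. by have [_ [_]] := ipP; apply. Qed.

Lemma ip_linearl a x y z : ip (a *: x + y) z = a * ip x z + ip y z.
Proof. by have [+ _] := ipP; apply. Qed.

Lemma ipDl x y z : ip (x + y) z = ip x z + ip y z.
Proof. by rewrite -[x]scale1r ip_linearl mul1r scale1r. Qed.

Lemma ip0l z : ip 0 z = 0.
Proof. by apply: (addrI (ip 0 z)); rewrite -ipDl !addr0. Qed.

Lemma ipZl a x z : ip (a *: x) z = a * ip x z.
Proof. by rewrite -[a *: x]addr0 ip_linearl ip0l addr0. Qed.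

Lemma ipNl x z : ip (- x) z = - ip x z.
Proof. by rewrite -scaleN1r ipZl mulN1r. Qed.

Lemma ipBl x y z : ip (x - y) z = ip x z - ip y z.
Proof. by rewrite ipDl ipNl. Qed.

Lemma ip_suml (I : Type) (s : seq I) (p : pred I) (F : I -> V) z :
  ip (\sum_(i <- s | p i) F i) z = \sum_(i <- s | p i) ip (F i) z.
Proof. by apply: (big_morph (ip^~ z)) => [x y|]; [exact: ipDl|exact: ip0l]. Qed.

Lemma ipDr x y z : ip z (x + y) = ip z x + ip z y.
Proof. by rewrite ipC ipDl !(ipC z). Qed.

Lemma ipZr a x z : ip z (a *: x) = a * ip z x.
Proof. by rewrite ipC ipZl ipC. Qed.

Lemma ip_sumr (I : Type) (s : seq I) (p : pred I) (F : I -> V) z :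
  ip z (\sum_(i <- s | p i) F i) = \sum_(i <- s | p i) ip z (F i).
Proof. by rewrite ipC ip_suml; apply: eq_bigr => i _; rewrite ipC. Qed.

Lemma normD_sqr x y : `|x + y| ^+ 2 = `|x| ^+ 2 + 2 * ip x y + `|y| ^+ 2.
Proof.
by rewrite -ip_norm ipDl !ipDr !ip_norm (ipC y x); ring.
Qed.

Lemma ip_polarization x y : ip x y = 2^-1 * (`|x + y| ^+ 2 - `|x| ^+ 2 - `|y| ^+ 2).
Proof. by rewrite normD_sqr; field. Qed.

(** The squared norm of [|y|^2 x - (x,y) y] expands to [|y|^2 (|x|^2 |y|^2 - (x,y)^2)], whose first
    factor is positive unless [y = 0]. *)
Lemma ip_cauchy_schwarz x y : `|ip x y| <= `|x| * `|y|.
Proof.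
have [->|y0] := eqVneq y 0; first by rewrite ipC ip0l normr0 mulr_ge0.
have y2 : 0 < `|y| ^+ 2 by rewrite exprn_gt0// normr_gt0.
have h : 0 <= `|y| ^+ 2 * ((`|x| * `|y|) ^+ 2 - ip x y ^+ 2).
  have := sqr_ge0 (`|(`|y| ^+ 2) *: x - ip x y *: y|).
  rewrite -scaleNr normD_sqr ipZl ipZr !normrZ normrN !exprMn.
  by rewrite !real_normK ?num_real//; congr (_ <= _); ring.
rewrite -(@ler_pXn2r _ 2)// ?nnegrE ?mulr_ge0// real_normK ?num_real//.
by rewrite -subr_ge0 -(pmulr_rge0 _ y2).
Qed.

(** First-order optimality: if [l x] and [ip r x] differed, a step from [r] along a suitable
    multiple of [x] would strictly lower the quadratic. *)
Lemma quadratic_minimizer_ip (l : V -> R) (r : V) :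
  (forall a x y, l (a *: x + y) = a * l x + l y) ->
  (forall x, `|r| ^+ 2 - 2 * l r <= `|x| ^+ 2 - 2 * l x) ->
  forall x, l x = ip r x.
Proof.
move=> ll rmin x; apply/eqP; rewrite -subr_eq0; apply/negPn/negP => a0.
set a := l x - ip r x in a0.
(* This step size gives [s |x|^2 = 1 - s], so that the quadratic drops by exactly
   [s a^2 (1 + s)]. *)
pose s := (`|x| ^+ 2 + 1)^-1.
have s0 : 0 < s by rewrite invr_gt0 ltr_wpDl// sqr_ge0.
have := rmin ((s * a) *: x + r); rewrite ll normD_sqr normrZ ipZl (ipC x).
have -> : (`|s * a| * `|x|) ^+ 2 = s * (a ^+ 2 * (s * `|x| ^+ 2)).
  by rewrite exprMn real_normK ?num_real//; ring.
have sx : s * `|x| ^+ 2 = 1 - s.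
  by rewrite /s; field; rewrite gt_eqF// ltr_wpDl// sqr_ge0.
rewrite sx leNgt => /negP; apply.
have e : l x = a + ip r x by rewrite /a; ring.
rewrite e -subr_gt0.
have -> : `|r| ^+ 2 - 2 * l r -
  (s * (a ^+ 2 * (1 - s)) + 2 * (s * a * ip r x) + `|r| ^+ 2 -
   2 * (s * a * (a + ip r x) + l r)) = s * a ^+ 2 * (1 + s) by ring.
by rewrite mulr_gt0 ?addr_gt0//; apply: mulr_gt0 => //; rewrite exprn_even_gt0.
Qed.

End inner_product.

Lemma linear_le_norm_continuous {R : realType} {V : normedModType R}
    (l : V -> R) (C : R) :
  (forall a x y, l (a *: x + y) = a * l x + l y) ->
  (forall x, `|l x| <= C * `|x|) -> continuous l.
Proof.
move=> ll lC x; apply/cvgrPdist_lt => e e0; near=> y.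
have -> : l x - l y = l (x - y) by rewrite [x - y]addrC -(scaleN1r y) ll mulN1r addrC.
apply: le_lt_trans (lC _) _.
have C1 : 0 < `|C| + 1 by rewrite ltr_wpDl.
apply: (@le_lt_trans _ _ ((`|C| + 1) * `|x - y|)).
  by rewrite ler_wpM2r//; have := ler_norm C; lra.
rewrite mulrC -ltr_pdivlMr//; near: y.
by apply: cvgr_dist_lt => //; rewrite divr_gt0.
Unshelve. all: by end_near. Qed.

(* The representative minimizes [J x = |x|^2 - 2 l x]; the parallelogram law
   makes every minimizing sequence of [J] Cauchy. *)
Lemma riesz_representation {R : realType} {V : completeNormedModType R}
    (ip : V -> V -> R) (l : V -> R) (C : R) :
  is_inner_product ip ->
  (forall a x y, l (a *: x + y) = a * l x + l y) ->
  (forall x, `|l x| <= C * `|x|) ->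
  exists r, forall x, l x = ip r x.
Proof.
move=> ipP ll lC.
pose J x := `|x| ^+ 2 - 2 * l x.
have JC x : - C ^+ 2 <= J x.
  have := le_trans (ler_norm _) (lC x); rewrite /J.
  have := sqr_ge0 (`|x| - C); rewrite sqrrB; lra.
have infJ : has_inf (range J).
  by split; [exists (J 0), 0|exists (- C ^+ 2) => _ [x _ <-]].
pose m := inf (range J).
have mJ x : m <= J x by apply: ge_inf; [case: infJ|exists x].
have gap x y : `|x - y| ^+ 2 <= 2 * (J x + J y - 2 * m).
  have := mJ (2^-1 *: x + 2^-1 *: y).
  have l0 : l 0 = 0 by have := ll 1 0 0; rewrite scale1r addr0 mul1r; lra.
  rewrite /J ll -[l (_ *: y)](_ : 2^-1 * l y = _); last first.
    by rewrite -[_ *: y]addr0 ll l0 addr0.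
  rewrite !(normD_sqr ipP) (ipZl ipP) (ipZr ipP) (ipC ipP x (- y)) (ipNl ipP).
  rewrite !normrZ normrN (ipC ipP y x) ger0_norm ?invr_ge0//.
  lra.
have /choice[u uJ] n : exists x, J x < m + n.+1%:R^-1.
  have n0 : 0 < n.+1%:R^-1 :> R by rewrite invr_gt0.
  by have [_ [x _ <-] ?] := inf_adherent n0 infJ; exists x.
have cvgu : cvg (u @ \oo).
  apply/cauchy_cvgP/cauchy_ballP => e e0; near_simpl.
  (* Two values of [J] within [e^2 / 4] of [m] make the bound in [gap] smaller than [e^2]. *)
  have e4 : 0 < e ^+ 2 / 4 by rewrite divr_gt0// exprn_gt0.
  near=> x => /=; rewrite -ball_normE /=.
  rewrite -(@ltr_pXn2r _ 2)// ?nnegrE ?(ltW e0)//.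
  apply: le_lt_trans (gap _ _) _.
  suff : J (u x.1) < m + e ^+ 2 / 4 /\ J (u x.2) < m + e ^+ 2 / 4 by lra.
  split; apply: lt_trans (uJ _) _; rewrite ltrD2l.
  - by near: x; exact: (cvg_fst (near_infty_natSinv_lt (PosNum e4))).
  - by near: x; exact: (cvg_snd (near_infty_natSinv_lt (PosNum e4))).
have lcont := linear_le_norm_continuous l C ll lC.
exists (lim (u @ \oo)); apply: quadratic_minimizer_ip => //.
move=> x; apply: le_trans (mJ x).
have cJ : J \o u @ \oo --> J (lim (u @ \oo)).
  apply: cvgB.
    by rewrite /= !expr2; apply: cvgM; exact: cvg_norm.
  apply: cvgM; first exact: cvg_cst.
  by apply: continuous_cvg; [exact: lcont|].
have cm : (fun n => m + n.+1%:R^-1) @ \oo --> m + 0.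
  by apply: cvgD; [exact: cvg_cst|exact: cvg_harmonic].
rewrite -[leRHS]addr0; apply: ler_cvg_to cJ cm _.
by near=> n; apply/ltW/uJ.
Unshelve. all: by end_near. Qed.

(** * Borel measurability in separable normed spaces *)

Lemma countable_bigcup_measurable d (T : measurableType d) (I : Type)
    (D : set I) (F : I -> set T) :
  countable D -> (forall i, D i -> measurable (F i)) ->
  measurable (\bigcup_(i in D) F i).
Proof.
move=> /pfcard_geP[->|[g]] mF; first by rewrite bigcup_set0.
have -> : \bigcup_(i in D) F i = \bigcup_n F (g n).
  apply/seteqP; split=> [x [i Di Fx]|x [n _ Fx]].
    by have [n _ gn] := @surj _ _ _ _ g _ Di; exists n => //; rewrite gn.
  by exists (g n) => //; exact: funS.
by apply: bigcupT_measurable => n; apply: mF; exact: funS.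
Qed.

Section borel.
Context {R : realType} {d : measure_display} {T : measurableType d}.

Lemma borel_measurable_continuous {V : topologicalType} (h : T -> V) (g : V -> R) :
  borel_measurable h -> continuous g -> measurable_fun setT (g \o h).
Proof.
move=> mh cg; apply: (measurability _ (RGenOInfty.measurableE R)).
move=> _ [_ [x ->] <-]; rewrite setTI; rewrite comp_preimage; apply: mh.
by apply: open_comp => [? _|]; [exact: cg|exact: interval_open].
Qed.

Lemma borel_measurable_comp {d' : measure_display} {T' : measurableType d'}
    {V : topologicalType} (X : T' -> T) (h : T -> V) :
  measurable_fun setT X -> borel_measurable h -> borel_measurable (h \o X).
Proof.
move=> mX mh O oO; have := mX measurableT _ (mh O oO).
by rewrite setTI.
Qed.

Lemma borel_measurable_cst {V : topologicalType} (v : V) :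
  borel_measurable (fun _ : T => v).
Proof. by move=> O _; rewrite preimage_cst; case: ifP. Qed.

End borel.

(** A point of [D] close enough to [a] serves as [v]. For countable [D] this turns a condition on
    [a + b] into a countable union of conditions that treat [a] and [b] separately. *)
Lemma dense_norm_split {R : realType} {V : normedModType R}
    (D : set V) (a b : V) (c : R) :
  closure D = setT -> `|a + b| < c ->
  exists2 v, D v & `|a - v| + `|v + b| < c.
Proof.
move=> dD abc; have e0 : 0 < (c - `|a + b|) / 2 by lra.
have : closure D a by rewrite dD.
move=> /(_ _ (nbhsx_ballx a _ e0))[v [Dv]].
rewrite -ball_normE /= => av; exists v => //.
have := ler_normD (v - a) (a + b); rewrite addrA subrK distrC; lra.
Qed.

Section separable.
Context {R : realType} {V : normedModType R}.
Hypothesis sepV : separable_space V.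

(** Without separability the sum could fail to be measurable for the product sigma-algebra. A
    countable dense set writes each sublevel set as a countable union of sets defined by norms of
    one coordinate each. *)
Lemma measurable_normD_pair d1 d2 (T1 : measurableType d1) (T2 : measurableType d2)
    (h1 : T1 -> V) (h2 : T2 -> V) :
  borel_measurable h1 -> borel_measurable h2 ->
  measurable_fun setT (fun z : T1 * T2 => `|h1 z.1 + h2 z.2|).
Proof.
move=> m1 m2; have [D [cD dD]] := sepV.
apply: (measurability _ (RGenInftyO.measurableE R)).
move=> _ [_ [c ->] <-]; rewrite setTI.
rewrite (_ : _ @^-1` _ = \bigcup_(v in D)
    [set z : T1 * T2 | `|h1 z.1 - v| + `|v + h2 z.2| < c]); last first.
  apply/seteqP; split=> [z /=|z [v Dv /=]]; rewrite in_itv/=.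
    by move=> /(dense_norm_split _ _ _ _ dD)[v Dv ?]; exists v.
  apply: le_lt_trans; rewrite -[X in `|X|](_ : (h1 z.1 - v) + (v + h2 z.2) = _).
    exact: ler_normD.
  by rewrite addrA subrK.
apply: countable_bigcup_measurable => // v _.
rewrite -[X in measurable X]setTI.
have -> : [set z : T1 * T2 | `|h1 z.1 - v| + `|v + h2 z.2| < c] =
   (fun z : T1 * T2 => `|h1 z.1 - v| + `|v + h2 z.2|) @^-1` `]-oo, c[%classic.
  by apply/seteqP; split=> z /=; rewrite in_itv.
apply: measurable_funD => //.
- apply: (@measurableT_comp _ _ _ _ _ _ (fun x => `|h1 x - v|)) => //.
  apply: (borel_measurable_continuous h1 (fun x => `|x - v|)) => // x.
  by apply: cvg_norm; apply: cvgB => //; exact: cvg_cst.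
- apply: (@measurableT_comp _ _ _ _ _ _ (fun x => `|v + h2 x|)) => //.
  apply: (borel_measurable_continuous h2 (fun x => `|v + x|)) => // x.
  by apply: cvg_norm; apply: cvgD => //; exact: cvg_cst.
Qed.

(** Polarization reduces this to norms of sums; the form on a product space is the one that Fubini
    requires. *)
Lemma measurable_ip_pair (ip : V -> V -> R) d1 d2 (T1 : measurableType d1)
    (T2 : measurableType d2) (h1 : T1 -> V) (h2 : T2 -> V) :
  is_inner_product ip -> borel_measurable h1 -> borel_measurable h2 ->
  measurable_fun setT (fun z : T1 * T2 => ip (h1 z.1) (h2 z.2)).
Proof.
move=> ipP m1 m2.
rewrite (_ : (fun _ => _) = fun z => 2^-1 *
  (`|h1 z.1 + h2 z.2| ^+ 2 - `|h1 z.1| ^+ 2 - `|h2 z.2| ^+ 2)); last first.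
  by apply/funext => z; rewrite (ip_polarization ipP).
apply: measurable_funM => //; apply: measurable_funB.
  apply: measurable_funB; apply: measurable_funX.
    exact: measurable_normD_pair.
  apply: (@measurableT_comp _ _ _ _ _ _ (fun x => `|h1 x|)) => //.
  by apply: (borel_measurable_continuous h1) => //; exact: norm_continuous.
apply: measurable_funX; apply: (@measurableT_comp _ _ _ _ _ _ (fun x => `|h2 x|)) => //.
by apply: (borel_measurable_continuous h2) => //; exact: norm_continuous.
Qed.

Lemma measurable_ip (ip : V -> V -> R) d1 (T1 : measurableType d1)
    (h1 h2 : T1 -> V) :
  is_inner_product ip -> borel_measurable h1 -> borel_measurable h2 ->
  measurable_fun setT (fun x => ip (h1 x) (h2 x)).
Proof.
move=> ipP m1 m2.
have mdiag : measurable_fun setT (fun x : T1 => (x, x)) by exact: measurable_fun_pair.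
exact: (measurableT_comp (measurable_ip_pair _ _ _ _ _ _ _ ipP m1 m2) mdiag).
Qed.

End separable.

(** * Integrals of functions of identically distributed variables *)

Section law.
Context {R : realType} {d d' : measure_display} {Omega : measurableType d}
  {T : measurableType d'} {P : probability Omega R} {X Y : {mfun Omega >-> T}}.
Hypothesis XY : forall A, measurable A -> P (X @^-1` A) = P (Y @^-1` A).
Local Open Scope ereal_scope.

Lemma ge0_integral_eq_law (g : T -> \bar R) : measurable_fun setT g ->
  (forall x, 0 <= g x) -> \int[P]_om g (X om) = \int[P]_om g (Y om).
Proof.
move=> mg g0; rewrite -!(ge0_integral_distribution _ mg)//.
by apply: eq_measure_integral => A mA _; exact: XY.
Qed.

Lemma integrable_eq_law (g : T -> \bar R) : measurable_fun setT g ->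
  P.-integrable setT (g \o Y) -> P.-integrable setT (g \o X).
Proof.
move=> mg /integrableP[_ gY]; apply/integrableP; split.
  exact: measurableT_comp.
rewrite (ge0_integral_eq_law (abse \o g)) => [//||x]; last exact: abse_ge0.
exact: measurableT_comp.
Qed.

Lemma integral_eq_law (g : T -> \bar R) : measurable_fun setT g ->
  P.-integrable setT (g \o Y) -> \int[P]_om g (X om) = \int[P]_om g (Y om).
Proof.
move=> mg gY; have gX := integrable_eq_law g mg gY.
rewrite -(integral_distribution mg gY) -(integral_distribution mg gX).
by apply: eq_measure_integral => A mA _; exact: XY.
Qed.

End law.

(** * Second moment of a sum of independent centred vectors *)

Section second_moment.
Context {R : realType} {d : measure_display} {Omega : measurableType d}
  {P : probability Omega R} {V : normedModType R} {ip : V -> V -> R}.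
Hypothesis ipP : is_inner_product ip.
Hypothesis sepV : separable_space V.

Lemma integrable_ip (a b : Omega -> V) :
  borel_measurable a -> borel_measurable b ->
  P.-integrable setT (fun om => (`|a om| ^+ 2)%:E) ->
  P.-integrable setT (fun om => (`|b om| ^+ 2)%:E) ->
  P.-integrable setT (fun om => (ip (a om) (b om))%:E).
Proof.
move=> ma mb ia ib; apply: le_integrable (integrableD measurableT ia ib) => //.
  by apply/measurable_EFinP; exact: measurable_ip.
move=> om _ /=; rewrite lee_fin [leRHS]ger0_norm ?addr_ge0 ?sqr_ge0//.
apply: le_trans (ip_cauchy_schwarz ipP _ _) _.
have := sqr_ge0 (`|a om| - `|b om|).
have := sqr_ge0 (`|a om|); have := sqr_ge0 (`|b om|).
rewrite sqrrB; lra.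
Qed.

Lemma integrable_norm_sqr_cst (v : V) : P.-integrable setT (fun=> (`|v| ^+ 2)%:E).
Proof. exact: finite_measure_integrable_cst. Qed.

(** Independence makes the joint law the product of the marginal laws. Fubini then integrates over
    [X] first, with the value [y] of [Y] frozen, and the inner integral is the zero mean tested
    against [Z2 y]. *)
Lemma integral_ip_independent d' (T : measurableType d')
    (X Y : {mfun Omega >-> T}) (Z1 Z2 : T -> V) :
  (forall A B, measurable A -> measurable B ->
    P (X @^-1` A `&` Y @^-1` B) = P (X @^-1` A) * P (Y @^-1` B))%E ->
  borel_measurable Z1 -> borel_measurable Z2 ->
  P.-integrable setT (fun om => (`|Z1 (X om)| ^+ 2)%:E) ->
  P.-integrable setT (fun om => (`|Z2 (Y om)| ^+ 2)%:E) ->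
  (forall v, \int[P]_om (ip (Z1 (X om)) v)%:E = 0)%E ->
  (\int[P]_om (ip (Z1 (X om)) (Z2 (Y om)))%:E = 0)%E.
Proof.
move=> indep mZ1 mZ2 i1 i2 mean0.
have mXY := measurable_fun_pair (measurable_funPT X) (measurable_funPT Y).
pose XY : {mfun Omega >-> (T * T)%type} :=
  HB.pack (fun om => (X om, Y om)) (isMeasurableFun.Build _ _ _ _ _ mXY).
pose f (z : T * T) : \bar R := (ip (Z1 z.1) (Z2 z.2))%:E.
have mip := measurable_ip_pair sepV _ _ _ _ _ _ _ ipP mZ1 mZ2.
have mf : measurable_fun setT f by exact/measurable_EFinP.
have lawE A : measurable A ->
    (distribution P X \x distribution P Y)%E A = distribution P XY A.
  exact: product_measure_unique.
have if_ : P.-integrable setT (f \o XY).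
  by apply: (integrable_ip (Z1 \o X) (Z2 \o Y)) => //; exact: borel_measurable_comp.
have ifXY : (distribution P X \x distribution P Y)%E.-integrable setT f.
  apply/integrableP; split => //.
  rewrite (eq_measure_integral (distribution P XY)); last by move=> A mA _; exact: lawE.
  by have /integrableP[] :=
    integrable_pushforward (measurable_funPT XY) mf if_ measurableT.
rewrite -(integral_distribution mf if_).
rewrite -(eq_measure_integral _ (fun A mA _ => lawE A mA)) -integral21_prod_meas1//.
rewrite integral0_eq// => y _.
rewrite [LHS]integral_distribution; first exact: (mean0 (Z2 y)).
- apply/measurable_EFinP; apply: (measurable_ip sepV _ _ _ Z1 (fun=> Z2 y)) => //.
  exact: borel_measurable_cst.
- apply: (integrable_ip (Z1 \o X) (fun=> Z2 y)) => //.
  + exact: borel_measurable_comp.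
  + exact: borel_measurable_cst.
  + exact: integrable_norm_sqr_cst.
Qed.

(** The square expands into a double sum of inner products: off-diagonal terms vanish by
    independence, and each of the [N] diagonal terms has the value given by the common law. *)
Lemma integral_norm_sqr_sum d' (T : measurableType d') (Y : {mfun Omega >-> T})
    (X : nat -> {mfun Omega >-> T}) (Z : T -> V) (N : nat) :
  (forall i A, measurable A -> P (X i @^-1` A) = P (Y @^-1` A)) ->
  mutually_independent P (fun i => X i : Omega -> T) ->
  borel_measurable Z ->
  P.-integrable setT (fun om => (`|Z (Y om)| ^+ 2)%:E) ->
  (forall v, \int[P]_om (ip (Z (Y om)) v)%:E = 0)%E ->
  (\int[P]_om (`|\sum_(i < N) Z (X i om)| ^+ 2)%:E =
   N%:R%:E * \int[P]_om (`|Z (Y om)| ^+ 2)%:E)%E.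
Proof.
move=> law indep mZ iZ mean0.
have mZ2 : measurable_fun setT (fun x => (`|Z x| ^+ 2)%:E).
  apply/measurable_EFinP/measurable_funX.
  by apply: (borel_measurable_continuous Z) => //; exact: norm_continuous.
have iX i : P.-integrable setT (fun om => (`|Z (X i om)| ^+ 2)%:E).
  exact: (integrable_eq_law (law i) _ mZ2 iZ).
have iXX i j : P.-integrable setT (fun om => (ip (Z (X i om)) (Z (X j om)))%:E).
  by apply: (integrable_ip (Z \o X i) (Z \o X j));
    [exact: borel_measurable_comp|exact: borel_measurable_comp|exact: iX|exact: iX].
have mean0X i v : (\int[P]_om (ip (Z (X i om)) v)%:E = 0)%E.
  rewrite -(mean0 v); apply: (integral_eq_law (law i) (fun x => (ip (Z x) v)%:E)).
    apply/measurable_EFinP; apply: (measurable_ip sepV _ _ _ Z (fun=> v)) => //.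
    exact: borel_measurable_cst.
  apply: (integrable_ip (Z \o Y) (fun=> v)) => //.
  - exact: borel_measurable_comp.
  - exact: borel_measurable_cst.
  - exact: integrable_norm_sqr_cst.
have cross i j : i != j -> (\int[P]_om (ip (Z (X i om)) (Z (X j om)))%:E = 0)%E.
  move=> ij; apply: integral_ip_independent => // A B mA mB.
  (* Pairwise independence is the case of a two-element index list; the family of sets is [A] at [i]
     and [B] at every other index. *)
  have := indep [:: i; j] (fun k => if k == i then A else B).
  rewrite /= inE ij => /(_ isT).
  rewrite big_cons big_seq1 eqxx eq_sym (negbTE ij) => <-; last by move=> k; case: ifP.
  congr (P _); apply/seteqP; split=> [om [/= XA YB] k|om /= h].
    by rewrite /= !inE => /orP[]/eqP ->; rewrite ?eqxx// eq_sym (negbTE ij).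
  split; first by have := h i; rewrite /= !inE eqxx; exact.
  by have := h j; rewrite /= !inE eqxx orbT eq_sym (negbTE ij); exact.
under eq_integral.
  move=> om _.
  rewrite -(ip_norm ipP) (ip_suml ipP) -sumEFin.
  under eq_bigr do rewrite (ip_sumr ipP) -sumEFin.
  over.
rewrite integral_sum//; last by move=> i; exact: integrable_sum.
rewrite (eq_bigr (fun=> \int[P]_om (`|Z (Y om)| ^+ 2)%:E))%E; last first.
  move=> i _; rewrite integral_sum// (bigD1 i)//= big1 ?adde0.
    under eq_integral do rewrite (ip_norm ipP).
    exact: (integral_eq_law (law i) _ mZ2 iZ).
  by move=> j ji; rewrite cross// eq_sym.
by rewrite sumr_const card_ord mule_natl.
Qed.

(** Expanding into inner products avoids proving that the vector-valued sum is Borel measurable. *)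
Lemma measurable_norm_sqr_sum (I : Type) (s : seq I) (a : I -> Omega -> V) :
  (forall i, borel_measurable (a i)) ->
  measurable_fun setT (fun om => `|\sum_(i <- s) a i om| ^+ 2).
Proof.
move=> ma; rewrite (_ : (fun _ => _) =
    fun om => \sum_(i <- s) \sum_(j <- s) ip (a i om) (a j om)); last first.
  apply/funext => om; rewrite -(ip_norm ipP) (ip_suml ipP).
  by apply: eq_bigr => i _; rewrite (ip_sumr ipP).
by apply: measurable_sum => i; apply: measurable_sum => j; exact: measurable_ip.
Qed.

End second_moment.

(** * Convex functions, dual functionals and the mean derivative *)

(** For [0 < t <= 1] convexity bounds the difference quotient along [v - u] by [g v - g u]; the
    bound passes to the limit from the right. *)
Lemma convex_ge_differential {R : realType} {V : normedModType R}
    (g : V -> R) (u v : V) :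
  (forall t, 0 <= t <= 1 -> g (t *: v + (1 - t) *: u) <= t * g v + (1 - t) * g u) ->
  differentiable g u -> 'd g u (v - u) <= g v - g u.
Proof.
move=> cvx dg; rewrite -deriveE//.
have /(diff_derivable (v := v - u)) cg := dg.
have := cvg_dnbhs_at_right cg.
move=> /cvgr_to_le; apply; near=> t.
have t0 : 0 < t by near: t; exact: nbhs_right_gt.
have t1 : t <= 1 by near: t; exact: nbhs_right_le.
rewrite /= /GRing.scale/= mulrC ler_pdivrMr//.
have -> : t *: (v - u) + u = t *: v + (1 - t) *: u.
  by rewrite scalerBr scalerBl scale1r addrAC -addrA.
have := cvx t; rewrite (ltW t0) t1 => /(_ isT); lra.
Unshelve. all: by end_near. Qed.

Section dual.
Context {R : realType} {V : normedModType R}.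

Lemma dual_norm_ge (phi : V -> R) (v : V) :
  is_dual phi -> `|phi v| <= dual_norm phi * `|v|.
Proof.
move=> [lphi cphi].
have phi0 : phi 0 = 0 by have := lphi 1 0 0; rewrite scale1r addr0 mul1r; lra.
have phiZ a x : phi (a *: x) = a * phi x.
  by rewrite -[a *: x]addr0 lphi phi0 addr0.
have [v0|v0] := eqVneq v 0; first by rewrite v0 phi0 !normr0 mulr0.
have nv : 0 < `|v| by rewrite normr_gt0.
have /cvgrPdist_lt/(_ _ ltr01)/nbhs_ballP[e /= e0 he] := cphi 0.
have bnd : has_ubound [set `|phi v| | v in [set v : V | `|v| <= 1]].
  (* Since [|phi| < 1] on the ball of radius [e] about 0, rescaling a unit-ball vector by [e / 2]
     gives this bound, which makes the [sup] in [dual_norm] a genuine supremum. *)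
  exists (2 / e) => _ [x /= x1 <-].
  have := he ((e / 2) *: x); rewrite -ball_normE /= phi0 !sub0r !normrN.
  have e2 : 0 <= e / 2 by lra.
  rewrite normrZ phiZ (normrM (e / 2)) (ger0_norm e2).
  have ex : e / 2 * `|x| < e.
    by apply: (@le_lt_trans _ _ (e / 2)); [rewrite ler_piMr|lra].
  move=> /(_ ex) /ltW; rewrite -ler_pdivlMl ?divr_gt0// mulr1.
  by rewrite invf_div.
have := ub_le_sup bnd; rewrite -/(dual_norm phi) => /(_ `|phi (`|v|^-1 *: v)|).
rewrite phiZ normrM ger0_norm ?invr_ge0// mulrC ler_pdivrMr//; apply.
exists (`|v|^-1 *: v); last by rewrite phiZ normrM ger0_norm ?invr_ge0// mulrC.
by rewrite /= normrZ ger0_norm ?invr_ge0// mulVf ?gt_eqF.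
Qed.

Lemma dual_measurable_apply d (T : measurableType d) (h : T -> V -> R) (v : V) :
  (forall x, is_dual (h x)) -> dual_measurable h ->
  measurable_fun setT (fun x => h x v).
Proof.
move=> dh mh; apply: (measurability _ (RGenOInfty.measurableE R)).
move=> _ [_ [c ->] <-]; rewrite setTI.
(* Restricting to dual elements matters: [dual_norm] of an unbounded function
   is the junk value [sup = 0], so [phi v > c] alone is not [dual_open]. *)
rewrite (_ : _ @^-1` _ = h @^-1` [set phi | is_dual phi /\ c < phi v]); last first.
  by apply/seteqP; split=> [x|x []] /=; rewrite in_itv/= andbT.
apply: mh => phi [dphi cphi].
have nv : 0 < `|v| + 1 by rewrite ltr_wpDl.
(* Within this radius the value at [v] moves by less than [phi v - c]; the added 1 covers
   [v = 0]. *)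
exists ((phi v - c) / (`|v| + 1)); first by rewrite divr_gt0// subr_gt0.
move=> psi dpsi; rewrite ltr_pdivlMr// => h1; split=> //.
have dd : is_dual (fun v => psi v - phi v).
  have [[l1 c1] [l2 c2]] := (dphi, dpsi); split=> [a x y|x].
    by rewrite l1 l2; ring.
  by apply: cvgB; [exact: c2|exact: c1].
have := dual_norm_ge _ v dd.
have h2 : dual_norm (fun v => psi v - phi v) * `|v| < phi v - c.
  have [n0|n0] := leP 0 (dual_norm (fun v => psi v - phi v)); first by lra.
  by apply: (@le_lt_trans _ _ 0); rewrite ?subr_gt0// mulr_le0_ge0// ltW.
have := ler_norm (- (psi v - phi v)); rewrite normrN; lra.
Qed.

End dual.

(** The adjoint identity for [Bstar] is available only on continuous linear functionals. Domination
    by [zeta] gives integrability, hence linearity, and continuity through the bound [E[zeta]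
    |v|]. *)
Lemma is_dual_DFexp {R : realType} {dO dX : measure_display}
    {Omega : measurableType dO} {P : probability Omega R} {Xi : measurableType dX}
    {W : normedModType R} (xi : Omega -> Xi) (Df : W -> Xi -> W -> R)
    (zeta : Xi -> R) (w : W) :
  measurable_fun setT xi -> (forall x, is_dual (Df w x)) -> dual_measurable (Df w) ->
  (forall x, dual_norm (Df w x) <= zeta x) ->
  P.-integrable setT (fun om => (zeta (xi om))%:E) ->
  is_dual (DFexp P xi Df w).
Proof.
move=> mxi dD mD Dzeta izeta.
have Dle om v : `|Df w (xi om) v| <= `|v| * zeta (xi om).
  by apply: le_trans (dual_norm_ge _ v (dD _)) _; rewrite mulrC ler_wpM2l.
have iv (v : W) : P.-integrable setT (EFin \o (fun om => `|v| * zeta (xi om))).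
  exact: (integrableZl measurableT `|v| izeta).
have iD v : P.-integrable setT (EFin \o (fun om => Df w (xi om) v)).
  apply: le_integrable (iv v) => //.
    apply/measurable_EFinP.
    exact: (measurableT_comp (dual_measurable_apply _ _ _ v dD mD) mxi).
  move=> om _; rewrite lee_fin; apply: le_trans (Dle _ _) (ler_norm _).
have iDN v : P.-integrable setT (EFin \o (fun om => `|Df w (xi om) v|)).
  exact: integrable_abse (iD v).
have lin a x y :
    DFexp P xi Df w (a *: x + y) = a * DFexp P xi Df w x + DFexp P xi Df w y.
  transitivity (\int[P]_om (a * Df w (xi om) x + Df w (xi om) y)).
    by apply: eq_Rintegral => om _; have [-> _] := dD (xi om).
  by rewrite RintegralD// ?RintegralZl//; exact: (integrableZl measurableT a (iD x)).
split=> //.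
apply: (linear_le_norm_continuous _ (\int[P]_om zeta (xi om)) lin) => v.
apply: (le_trans (le_normr_Rintegral measurableT (iD v))).
apply: (le_trans (le_Rintegral measurableT (iDN v) (iv v) (fun om _ => Dle om v))).
by rewrite RintegralZl// mulrC.
Qed.

(** * From the growth condition to the mean error estimate *)

(** For [r > 0] one factor [r] cancels before squaring. At [r = 0] the left side vanishes because
    the exponent [2 (rho - 1)] is positive. *)
Lemma powR_growth_sqr {R : realType} (theta r rho K : R) :
  0 < theta -> 1 < rho -> 0 <= r -> theta * r `^ rho <= K * r ->
  theta ^+ 2 * r `^ (2 * (rho - 1)) <= K ^+ 2.
Proof.
move=> theta0 rho1; rewrite le_eqVlt => /predU1P[<- _|r0].
  by rewrite powR0 ?mulr0 ?sqr_ge0// gt_eqF// mulr_gt0// subr_gt0.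
have -> : r `^ rho = r `^ (rho - 1) * r.
  have nz : (rho - 1 + 1 == 0) ==> (r != 0) by rewrite (gt_eqF r0) implybT.
  by rewrite -{1}(subrK 1 rho) (powRD nz) powRr1// ltW.
rewrite mulrA ler_pM2r// => h.
rewrite mulrC [2 * _]mulrC powRrM powR_mulrn ?powR_ge0// -exprMn mulrC.
by rewrite ler_pXn2r// nnegrE ?(le_trans _ h)// mulr_ge0 ?powR_ge0// ltW.
Qed.

Theorem theorem3p11
  (R : realType)
  (* the Hilbert space U (identified with its dual via ipU) *)
  (U : completeNormedModType R) (ipU : U -> U -> R)
  (* the Banach space W; elements of W^* are represented as functions W -> R *)
  (W : completeNormedModType R)
  (B : {linear U -> W}) (Bstar : (W -> R) -> U)
  (psi : U -> \bar R) (U0 : set U)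
  (dXi : measure_display) (Xi : measurableType dXi)
  (dO : measure_display) (Omega : measurableType dO) (P : probability Omega R)
  (xi : Omega -> Xi) (xis : nat -> Omega -> Xi)
  (f : W -> Xi -> R) (zeta_f : Xi -> R)
  (grad : Xi -> U -> U) (Df : W -> Xi -> W -> R) (zeta_Df : Xi -> R)
  (ustar : U) (uN : nat -> Omega -> U)
  (* the Banach space UU (= script U) with U^* embedded in U and U embedded in UU *)
  (UU : completeNormedModType R) (jU : {linear U -> UU}) (kU : (UU -> R) -> U)
  (* the Hilbert space H embedded in UU^* *)
  (H : completeNormedModType R) (ipH : H -> H -> R) (eH : H -> (UU -> R))
  (C_H : R) (theta rho : R) (gradH : Xi -> H) (meanH : H) :
  let domPsi := [set u | (psi u < +oo)%E] in
  let BdomPsi := B @` domPsi in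
  let BU0 := B @` U0 in
  (* U : separable Hilbert space; W : separable Banach space *)
  is_inner_product ipU -> separable_space U ->
  separable_space W ->
  (* B compact linear operator, Bstar its adjoint *)
  continuous B ->
  compact (closure (B @` [set u : U | `|u| <= 1])) ->
  (forall phi, is_dual phi -> forall u, ipU (Bstar phi) u = phi (B u)) ->
  (* psi : U -> [0, oo] proper, closed (lsc), convex, with bounded domain *)
  (forall u, (0 <= psi u)%E) ->
  (exists u, (psi u < +oo)%E) ->
  (forall c : R, closed [set u | (psi u <= c%:E)%E]) ->
  (forall (u v : U) (t : R), 0 < t < 1 ->
     (psi (t *: u + (1 - t) *: v)%R <= t%:E * psi u + (1 - t)%R%:E * psi v)%E) ->
  bounded_set domPsi ->
  (* U0 open, convex, bounded, containing dom psi *)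
  open U0 -> convex_set U0 -> bounded_set U0 -> domPsi `<=` U0 ->
  (* Xi complete separable metric space (with its Borel sets),
     complete probability space, xi and i.i.d. copies xis *)
  polish_borel R Xi ->
  measure_is_complete P ->
  measurable_fun setT xi ->
  (forall i, measurable_fun setT (xis i)) ->
  (forall i (A : set Xi), measurable A -> P (xis i @^-1` A) = P (xi @^-1` A)) ->
  mutually_independent P xis ->
  (* assumptions on f *)
  (forall x, {within BdomPsi, continuous (fun w => f w x)}) ->
  (forall w, BU0 w -> measurable_fun setT (f w)) ->
  measurable_fun setT zeta_f ->
  P.-integrable setT (fun om => (zeta_f (xi om))%:E) ->
  (forall u x, U0 u -> `|f (B u) x| <= zeta_f x) ->
  (* g_xi(u) = f(Bu, xi) is continuously differentiable on U0, gradient grad *)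
  (forall x u, U0 u ->
     differentiable (fun v => f (B v) x) u /\
     forall h, 'd (fun v => f (B v) x) u h = ipU (grad x u) h) ->
  (forall x u, U0 u -> {for u, continuous (grad x)}) ->
  (* D_w f : B(dom psi) x Xi -> W^* is a Caratheodory map *)
  (forall w x, BdomPsi w -> is_dual (Df w x)) ->
  (forall x w, BdomPsi w -> forall e : R, 0 < e -> exists2 d : R, 0 < d &
     forall w', BdomPsi w' -> `|w' - w| < d ->
       dual_norm (fun v => Df w' x v - Df w x v) < e) ->
  (forall w, BdomPsi w -> dual_measurable (Df w)) ->
  (forall x u, domPsi u -> grad x u = Bstar (Df (B u) x)) ->
  measurable_fun setT zeta_Df ->
  P.-integrable setT (fun om => (zeta_Df (xi om))%:E) ->
  (forall x u, U0 u -> `|grad x u| <= zeta_Df x) ->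
  (forall x u, domPsi u -> dual_norm (Df (B u) x) <= zeta_Df x) ->
  (* u* solves min_u F(Bu) + psi(u) *)
  (forall u, ((Fexp P xi f (B ustar))%:E + psi ustar <=
              (Fexp P xi f (B u))%:E + psi u)%E) ->
  (* u_N^* measurable, solves the SAA problem pointwise *)
  (forall N, (0 < N)%N -> borel_measurable (uN N)) ->
  (forall N, (0 < N)%N -> forall om u,
     ((FhatN xis f N (B (uN N om)) om)%:E + psi (uN N om) <=
      (FhatN xis f N (B u) om)%:E + psi u)%E) ->
  (* UU^* embedded in U, U embedded in UU *)
  injective jU -> continuous jU ->
  (forall (a : R) (phi phi' : UU -> R), is_dual phi -> is_dual phi' ->
     kU (fun v => a * phi v + phi' v) = a *: kU phi + kU phi') ->
  (forall phi phi' : UU -> R, is_dual phi -> is_dual phi' ->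
     kU phi = kU phi' -> phi = phi') ->
  (exists c : R, forall phi : UU -> R, is_dual phi ->
     `|kU phi| <= c * dual_norm phi) ->
  (forall phi : UU -> R, is_dual phi -> forall u : U,
     `|ipU (kU phi) u| <= dual_norm phi * `|jU u|) ->
  (* H separable Hilbert space embedded in UU^* with constant C_H *)
  is_inner_product ipH -> separable_space H ->
  (forall h, is_dual (eH h)) ->
  (forall (a : R) (h h' : H), eH (a *: h + h') = (fun v => a * eH h v + eH h' v)) ->
  injective eH ->
  (forall h, dual_norm (eH h) <= C_H * `|h|) ->
  (* growth condition *)
  0 < theta -> 2 <= rho ->
  (forall u, ((ipU (Bstar (DFexp P xi Df (B ustar))) (u - ustar)%R)%:E
               + psi u - psi ustar >= (theta * `|jU (u - ustar)| `^ rho)%R%:E)%E) ->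
  (* xi |-> grad g_xi at ustar is an integrable H-valued map, with mean meanH
     and finite variance sigma_Df^2 *)
  (forall x, kU (eH (gradH x)) = grad x ustar) ->
  borel_measurable gradH ->
  P.-integrable setT (fun om => (`|gradH (xi om)|)%:E) ->
  (forall h, ipH meanH h = fine (\int[P]_om (ipH (gradH (xi om)) h)%:E)%E) ->
  (\int[P]_om (`|gradH (xi om) - meanH| ^+ 2)%R%:E < +oo)%E ->
  (* f(., xi) convex *)
  (forall x (w1 w2 : W) (t : R), BU0 w1 -> BU0 w2 -> 0 <= t <= 1 ->
     f (t *: w1 + (1 - t) *: w2) x <= t * f w1 x + (1 - t) * f w2 x) ->
  (* conclusion *)
  forall N : nat, (0 < N)%N ->
    ((theta ^+ 2)%R%:E *
       \int[P]_om (`|jU (uN N om - ustar)| `^ (2 * (rho - 1)))%R%:E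
     <= (N%:R^-1 * C_H ^+ 2 *
         fine (\int[P]_om (`|gradH (xi om) - meanH| ^+ 2)%R%:E))%R%:E)%E.
Proof.
move=> domPsi BdomPsi BU0 ipUP _ _ _ _ adjB psi_ge0 [u0 psi_u0] _ _ _ _ _ _ domU0.
move=> _ _ mxi mxis law indep _ _ _ _ _ dg _ dual_Df _ mDf gradE _ izeta _ Dfzeta.
move=> ustar_min muN uN_min _ jU_cont kU_lin _ _ kU_le ipHP sepH dual_eH eH_lin _ eH_le.
move=> theta0 rho2 growth gradHE mgradH igradH meanHP varH cvxf N N0.
(* Comparison with a point where [psi] is finite forces [psi] to be finite at the minimizer. *)
have dom_ustar : domPsi ustar.
  have : ((Fexp P xi f (B ustar))%:E + psi ustar < +oo)%E.
    by apply: le_lt_trans (ustar_min u0) _; rewrite lte_add_pinfty// ltry.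
  by rewrite /domPsi/= !ltey; apply: contra_neq => ->; rewrite addey.
have dom_uN om : domPsi (uN N om).
  have : ((FhatN xis f N (B (uN N om)) om)%:E + psi (uN N om) < +oo)%E.
    by apply: le_lt_trans (uN_min N N0 om ustar) _; rewrite lte_add_pinfty// ltry.
  by rewrite /domPsi/= !ltey; apply: contra_neq => ->; rewrite addey.
have psi_fin u : domPsi u -> psi u = (fine (psi u))%:E.
  by move=> du; rewrite fineK// ge0_fin_numE.
pose L h z := ipU (kU (eH z)) h.
have L_lin h a x y : L h (a *: x + y) = a * L h x + L h y.
  by rewrite /L eH_lin kU_lin// (ip_linearl ipUP).
have L_le h z : `|L h z| <= (C_H * `|jU h|) * `|z|.
  apply: le_trans (kU_le _ (dual_eH z) h) _.
  by rewrite mulrAC ler_wpM2r.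
have DF_dual : is_dual (DFexp P xi Df (B ustar)).
  have Bu : BdomPsi (B ustar) by exists ustar.
  by apply: (is_dual_DFexp _ _ zeta_Df) => //;
    [move=> x; exact: dual_Df|exact: mDf|move=> x; exact: Dfzeta].
have gradient_mean h : ipU (Bstar (DFexp P xi Df (B ustar))) h = L h meanH.
  have [r Lr] := riesz_representation _ _ _ ipHP (L_lin h) (L_le h).
  rewrite adjB// Lr (ipC ipHP) meanHP /DFexp; congr fine.
  apply: eq_integral => om _; congr EFin.
  rewrite (ipC ipHP) -Lr /L gradHE gradE// adjB//.
  by apply: dual_Df; exists ustar.
pose Z x := gradH x - meanH.
pose S om := \sum_(i < N) Z (xis i om).
have key om : theta * `|jU (uN N om - ustar)| `^ rho <=
    (C_H * `|N%:R^-1 *: S om|) * `|jU (uN N om - ustar)|.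
  set h := uN N om - ustar.
  have N0R : 0 < N%:R^-1 :> R by rewrite invr_gt0 ltr0n.
  have subgrad : N%:R^-1 * \sum_(i < N) L h (gradH (xis i om)) <=
      FhatN xis f N (B (uN N om)) om - FhatN xis f N (B ustar) om.
    rewrite /FhatN -mulrBr ler_pM2l// -sumrB; apply: ler_sum => i _.
    have [dgi dgE] := dg (xis i om) ustar (domU0 _ dom_ustar).
    rewrite /L gradHE -dgE; apply: convex_ge_differential dgi => t t01.
    rewrite linearD !linearZ/=; apply: cvxf => //;
      [exists (uN N om)|exists ustar] => //; exact: domU0.
  have := uN_min N N0 om ustar; have := growth (uN N om).
  rewrite (psi_fin _ dom_ustar) (psi_fin _ (dom_uN om)) gradient_mean -/h !lee_fin.
  (* The sign is flipped because [L h] at [- N^-1 S] is the mean gradient minus the sample gradient,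
     both paired with [h]. *)
  have -> : `|N%:R^-1 *: S om| = `| - (N%:R^-1 *: S om)| by rewrite normrN.
  have := le_trans (ler_norm _) (L_le h (- (N%:R^-1 *: S om))).
  have L0 : L h 0 = 0 by have := L_lin h 1 0 0; rewrite scale1r addr0 mul1r; lra.
  have LD x y : L h (x + y) = L h x + L h y by rewrite -[x]scale1r L_lin mul1r scale1r.
  have LZ a x : L h (a *: x) = a * L h x by rewrite -[a *: x]addr0 L_lin L0 addr0.
  have -> : L h (- (N%:R^-1 *: S om)) =
      L h meanH - N%:R^-1 * \sum_(i < N) L h (gradH (xis i om)).
    rewrite -scaleN1r !LZ /S (big_morph (L h) LD L0).
    under eq_bigr do rewrite /Z -scaleN1r LD LZ.
    rewrite big_split/= sumr_const card_ord mulN1r -mulr_natr mulrDr mulrC.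
    by field; rewrite pnatr_eq0 -lt0n.
  rewrite mulrAC; lra.
pose Y : {mfun Omega >-> Xi} := HB.pack xi (isMeasurableFun.Build _ _ _ _ _ mxi).
pose X i : {mfun Omega >-> Xi} :=
  HB.pack (xis i) (isMeasurableFun.Build _ _ _ _ _ (mxis i)).
have mZ : borel_measurable Z.
  move=> O oO; apply: (mgradH ((fun z => z - meanH) @^-1` O)).
  by apply: open_comp => // x _; apply: cvgB => //; exact: cvg_cst.
have mZxi : borel_measurable (Z \o xi) by exact: borel_measurable_comp.
have iZ : P.-integrable setT (fun om => (`|Z (xi om)| ^+ 2)%:E).
  apply/integrableP; split.
    apply/measurable_EFinP/measurable_funX.
    by apply: (borel_measurable_continuous (Z \o xi)) => //; exact: norm_continuous.
  by under eq_integral do rewrite gee0_abs ?lee_fin ?sqr_ge0//.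
have Z0 v : (\int[P]_om (ipH (Z (xi om)) v)%:E = 0)%E.
  have iv : P.-integrable setT (EFin \o (fun om => ipH (gradH (xi om)) v)).
    apply: le_integrable (integrableZl measurableT `|v| igradH) => //.
      apply/measurable_EFinP/(measurable_ip sepH _ _ _ (gradH \o xi) (fun=> v)) => //.
        exact: borel_measurable_comp.
      exact: borel_measurable_cst.
    move=> om _; rewrite lee_fin; apply: le_trans (ip_cauchy_schwarz ipHP _ _) _.
    by rewrite mulrC ler_norm.
  under eq_integral do rewrite (ipBl ipHP) EFinB.
  rewrite integralB_EFin//; last exact: finite_measure_integrable_cst.
  rewrite (integral_cst P measurableT (ipH meanH v)%:E).
  (* [meanHP] determines the integral only up to [fine]; integrability of the pairing makes it
     finite, so the extended-real difference is 0. *)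
  rewrite [X in (_ * X)%E](probability_setT P) mule1 meanHP fineK ?subee//;
    exact: integrable_fin_num.
have ES : (\int[P]_om (`|S om| ^+ 2)%:E =
    N%:R%:E * \int[P]_om (`|Z (xi om)| ^+ 2)%:E)%E.
  exact: (integral_norm_sqr_sum ipHP sepH _ _ Y X).
(* This is the factor of [|S|^2] in [(C_H |N^-1 S|)^2]; multiplied by the [N] of [ES] it leaves
   [C_H^2 / N]. *)
pose c := C_H ^+ 2 * N%:R^-1 ^+ 2.
have c0 : 0 <= c by rewrite mulr_ge0 ?sqr_ge0.
have mS : measurable_fun setT (fun om => (`|S om| ^+ 2)%:E).
  apply/measurable_EFinP; apply: (measurable_norm_sqr_sum ipHP sepH) => i.
  exact: borel_measurable_comp.
have mr : measurable_fun setT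
    (fun om => (`|jU (uN N om - ustar)| `^ (2 * (rho - 1)))%:E).
  apply/measurable_EFinP.
  apply: (measurableT_comp (measurable_powR _)).
  apply: (borel_measurable_continuous (uN N) (fun u => `|jU (u - ustar)|)).
    exact: muN.
  move=> u; apply: cvg_norm; apply: continuous_cvg; first exact: jU_cont.
  by apply: cvgB => //; exact: cvg_cst.
apply: (@le_trans _ _ (\int[P]_om (c%:E * (`|S om| ^+ 2)%:E))%E).
  rewrite -ge0_integralZl_EFin// ?sqr_ge0//.
  apply: ge0_le_integral => //.
  - by move=> om _; rewrite -EFinM lee_fin mulr_ge0 ?sqr_ge0 ?powR_ge0.
  - exact: measurable_funeM.
  - exact: measurable_funeM.
  - move=> om _; rewrite -!EFinM lee_fin.
    have -> : c * `|S om| ^+ 2 = (C_H * `|N%:R^-1 *: S om|) ^+ 2.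
      by rewrite normrZ ger0_norm ?invr_ge0// /c; ring.
    by apply: powR_growth_sqr (key om) => //; lra.
rewrite ge0_integralZl_EFin//.
rewrite ES -[X in (_ * (_ * X) <= _)%E]fineK; last exact: integrable_fin_num.
rewrite -!EFinM lee_fin mulrA ler_wpM2r//.
  by rewrite fine_ge0// integral_ge0// => om _; rewrite lee_fin sqr_ge0.
rewrite le_eqVlt; apply/orP; left; apply/eqP; rewrite /c.
by field; rewrite pnatr_eq0 -lt0n.
Qed.
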